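(* Let $d\in\{1,2\}$, let $M,C,k,S$ be positive integers with $k$ odd, and let $N$ be a positive integer such that $SN\geq 2k-1$. For a convolutional layer defined using circular boundary conditions with kernel tensor $\mathbf{K}\in\mathbb{K}_d$, we have $$\alpha'\,L_{orth}(\mathbf{K})\;\leq\;\left(\mathrm{err}^s_N(\mathbf{K})\right)^2\;\leq\;\alpha\,L_{orth}(\mathbf{K}),$$ where $\alpha'=\dfrac{1}{\min(M,CS^2)}$ and $$\alpha=\begin{cases}\left(2\left\lfloor\frac{k-1}{S}\right\rfloor+1\right)^dM&\text{in the RO case }(M\le CS^d),\\(2k-1)^dC&\text{in the CO case }(M\ge CS^d).\end{cases}$$
   Context: Write $k=2r+1$, and let $a\%n\in\{0,\dots,n-1\}$ denote the remainder of $a$ modulo $n$. Kernel tensors: $\mathbb{K}_1=\mathbb{R}^{M\times C\times k}$, $\mathbb{K}_2=\mathbb{R}^{M\times C\times k\times k}$; kernel spatial indices run from $0$ to $k-1$. Layer transform matrix (circular boundary conditions). For $d=1$, $\mathcal{K}\in\mathbb{R}^{MN\times CSN}$ is the matrix (after vectorization) of the linear map $X\in\mathbb{R}^{C\times SN}\mapsto Y\in\mathbb{R}^{M\times N}$, $$Y_{m,i}=\sum_{c=1}^C\sum_{i'=0}^{k-1}\mathbf{K}_{m,c,i'}X_{c,(i'+Si-r)\%SN},\quad 0\le i\le N-1.$$ For $d=2$, $\mathcal{K}\in\mathbb{R}^{MN^2\times CS^2N^2}$ is the matrix of $X\in\mathbb{R}^{C\times SN\times SN}\mapsto Y\in\mathbb{R}^{M\times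 N\times N}$, $$Y_{m,i,j}=\sum_{c=1}^C\sum_{i',j'=0}^{k-1}\mathbf{K}_{m,c,i',j'}X_{c,(i'+Si-r)\%SN,(j'+Sj-r)\%SN},\quad 0\le i,j\le N-1.$$ Orthogonality error in spectral norm: $\mathrm{err}^s_N(\mathbf{K})=\|\mathcal{K}\mathcal{K}^T-\mathrm{Id}_{MN^d}\|_2$ in the RO case ($M\le CS^d$), and $\mathrm{err}^s_N(\mathbf{K})=\|\mathcal{K}^T\mathcal{K}-\mathrm{Id}_{CS^dN^d}\|_2$ in the CO case ($M\ge CS^d$), where $\|\cdot\|_2$ is the spectral norm (largest singular value). When $M=CS^d$ the definitions coincide, and the upper bound holds with either value of $\alpha$. The function $L_{orth}$. Let $P=\lfloor\frac{k-1}{S}\rfloor S$. For $d=1$, let $\mathbf{T}\in\mathbb{R}^{M\times M\times(2P/S+1)}$ be $$\mathbf{T}_{m,l,i}=\sum_{c=1}^C\sum_{i'=0}^{k-1}\mathbf{K}_{m,c,i'}\,\mathbf{K}_{l,c,\,i'+Si-P},\quad 0\le i\le 2P/S,$$ and for $d=2$, let $\mathbf{T}\in\mathbb{R}^{M\times M\times(2P/S+1)\times(2P/S+1)}$ be $$\mathbf{T}_{m,l,i,j}=\sum_{c=1}^C\sum_{i',j'=0}^{k-1}\mathbf{K}_{m,c,i',j'}\,\mathbf{K}_{l,c,\,i'+Si-P,\,j'+Sj-P},\quad 0\le i,j\le 2P/S,$$ where entries of $\mathbf{K}$ with a spatial index outside $\{0,\dots,k-1\}$ are taken to be $0$ (zero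 padding). Let $\mathbf{I_{r0}}$ be the tensor of the same size as $\mathbf{T}$ all of whose entries are zero except its central $M\times M$ slice (spatial index $P/S$ if $d=1$, $(P/S,P/S)$ if $d=2$), which equals $\mathrm{Id}_M$. With $\|\cdot\|_F$ the square root of the sum of squares of all entries, $$L_{orth}(\mathbf{K})=\|\mathbf{T}-\mathbf{I_{r0}}\|_F^2\ \text{ in the RO case},\qquad L_{orth}(\mathbf{K})=\|\mathbf{T}-\mathbf{I_{r0}}\|_F^2-(M-CS^d)\ \text{ in the CO case}.$$ *)

(* Defs.v *)
From mathcomp Require Import all_boot all_order all_algebra.
From mathcomp Require Import classical_sets reals.

Set Implicit Arguments.
Unset Strict Implicit.
Unset Printing Implicit Defensive.

Import Order.TTheory GRing.Theory Num.Theory.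
Local Open Scope classical_set_scope.
Local Open Scope ring_scope.

(* Spatial positions of a d-dimensional array of side n: for d = 1 this is
   {0..n-1}, for d = 2 it is {0..n-1}^2.  A tensor in R^(A x B x n^d) is a
   function 'I_A -> 'I_B -> grid d n -> R. *)
Notation grid d n := {ffun 'I_d -> 'I_n}.

(* Value of an array at integer coordinates, 0 outside {0..n-1}^d. *)
Definition entry (R : realType) (d n : nat) (t : grid d n -> R)
    (p : 'I_d -> int) : R :=
  if [pick q : grid d n | [forall s, (q s)%:Z == p s]] is Some q
  then t q else 0.

(* Strided convolution with circular boundary conditions; r = k./2 for odd
   k = 2r + 1.  The remainder is taken in int because i' + S i - r may be
   negative; it lies in {0..SN-1}, so [entry] never pads here. *)
Definition conv (R : realType) (d M C k S N : nat)
    (K : 'I_M -> 'I_C -> grid d k -> R)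
    (X : 'I_C -> grid d (S * N) -> R) (m : 'I_M) (i : grid d N) : R :=
  \sum_(c < C) \sum_(i' : grid d k)
    K m c i' *
    entry (X c) (fun s => (((i' s)%:Z + S%:Z * (i s)%:Z - (k./2)%:Z)
                             %% (S * N)%N%:Z)%Z).

(* Matrix of X |-> conv K X: column q is the image of the q-th standard basis
   tensor, tensors being vectorized along [enum]. *)
Definition layer_mx (R : realType) (d M C k S N : nat)
    (K : 'I_M -> 'I_C -> grid d k -> R) :
    'M[R]_(#|{: 'I_M * grid d N}|, #|{: 'I_C * grid d (S * N)}|) :=
  \matrix_(p, q)
    conv K (fun c x => ((c, x) == enum_val q)%:R)
      (enum_val p).1 (enum_val p).2.

Definition singular_value (R : realType) (m n : nat) (A : 'M[R]_(m, n))
    (s : R) : Prop :=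
  0 <= s /\ eigenvalue (A^T *m A) (s ^+ 2).

(* The set is finite, so the supremum is the largest singular value. *)
Definition spectral_norm (R : realType) (m n : nat) (A : 'M[R]_(m, n)) : R :=
  sup [set s | singular_value A s].

(* Row orthogonality (M <= C S^d) and column orthogonality (M >= C S^d);
   both cases apply when M = C S^d. *)
Inductive orth_case := RO | CO.

Definition applicable (o : orth_case) (d M C S : nat) : bool :=
  match o with
  | RO => (M <= C * S ^ d)%N
  | CO => (C * S ^ d <= M)%N
  end.

Definition err_s (R : realType) (o : orth_case) (d M C k S N : nat)
    (K : 'I_M -> 'I_C -> grid d k -> R) : R :=
  let A := layer_mx S N K in
  match o with
  | RO => spectral_norm (A *m A^T - 1%:M)
  | CO => spectral_norm (A^T *m A - 1%:M)
  end.

Definition padding (k S : nat) : nat := (k - 1) %/ S * S.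

Notation tsize k S := (2 * padding k S %/ S + 1)%N.

Definition autocorr (R : realType) (d M C k S : nat)
    (K : 'I_M -> 'I_C -> grid d k -> R)
    (m l : 'I_M) (i : grid d (tsize k S)) : R :=
  \sum_(c < C) \sum_(i' : grid d k)
    K m c i' *
    entry (K l c)
      (fun s => (i' s)%:Z + S%:Z * (i s)%:Z - (padding k S)%:Z).

Definition Ir0 (R : realType) (d M k S : nat)
    (m l : 'I_M) (i : grid d (tsize k S)) : R :=
  ((m == l) && [forall s, i s == (padding k S %/ S)%N :> nat])%:R.

Definition frobenius (R : realType) (A B : nat) (I : finType)
    (t : 'I_A -> 'I_B -> I -> R) : R :=
  Num.sqrt (\sum_(a < A) \sum_(b < B) \sum_(i : I) t a b i ^+ 2).

Definition Lorth (R : realType) (o : orth_case) (d M C k S : nat)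
    (K : 'I_M -> 'I_C -> grid d k -> R) : R :=
  let e := frobenius (fun m l i => autocorr (S := S) K m l i - Ir0 R m l i)
             ^+ 2 in
  match o with
  | RO => e
  | CO => e - (M%:R - (C * S ^ d)%:R)
  end.

Definition alpha (R : realType) (o : orth_case) (d M C k S : nat) : R :=
  match o with
  | RO => ((2 * ((k - 1) %/ S) + 1) ^ d * M)%:R
  | CO => ((2 * k - 1) ^ d * C)%:R
  end.

Definition alpha' (R : realType) (M C S : nat) : R :=
  1 / (minn M (C * S ^ 2))%:R.

(* Main.v *)
(* Write A for the layer matrix, q = (k - 1) / S and D = T - I_r0.  Grouping the
   products of kernel entries by the offset of the two output positions gives
   (A A^T - Id)_((m,i),(l,j)) = sum of D_(m,l,n) over the n with
   j = i + q - n mod N.  By Cauchy-Schwarz the l^1 norm of each row is at most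
   sqrt (M (2q+1)^d) |D|_F, and it bounds the spectral norm of a symmetric
   matrix.  As 2q < N the offset n is determined by (i, j), so
   |A A^T - Id|_F^2 = N^d |D|_F^2; comparing with (size) * (spectral norm)^2
   yields the lower bound.
   In the CO case, |A^T A - Id|_F^2 = |A A^T - Id|_F^2 - M N^d + C S^d N^d
   = N^d L_orth by cyclicity of the trace.  The rows of A^T A - Id are supported
   on C (2k-1)^d entries, and A^T A is invariant under the N^d translations by
   multiples of S, so each row has squared l^2 norm at most L_orth.
   If M = C S^d, then A is square and A A^T - Id, A^T A - Id have the same
   singular values, hence both values of alpha apply. *)
Require Import Defs.
From mathcomp Require Import all_boot all_order all_algebra.
From mathcomp Require Import classical_sets reals.
From mathcomp Require Import spectral complex zify ring.
(* [tuple] also exports a [tsize]; the one of [Defs] is meant. *)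
Import Defs.

Set Implicit Arguments.
Unset Strict Implicit.
Unset Printing Implicit Defensive.

Import Order.TTheory GRing.Theory Num.Theory.
Local Open Scope ring_scope.

(** * Finite sums and Cauchy-Schwarz *)

Lemma sum_enum_val (V : nmodType) (T : finType) (F : T -> V) :
  \sum_(p < #|{: T}|) F (enum_val p) = \sum_x F x.
Proof. by rewrite -(big_enum_val F). Qed.

(** Cauchy-Schwarz against the constant 1, obtained by summing [2 x y <= x^2 + y^2] over all
    pairs. *)
Lemma sqr_sum_le_card (R : realFieldType) (I : finType) (P : {pred I})
    (f : I -> R) :
  (\sum_(i in P) f i) ^+ 2 <= #|P|%:R * \sum_(i in P) f i ^+ 2.
Proof.
have E1 : \sum_(i in P) \sum_(j in P) f i ^+ 2 =
    #|P|%:R * \sum_(i in P) f i ^+ 2.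
  by rewrite mulr_sumr; apply: eq_bigr => i _; rewrite sumr_const mulr_natl.
have E2 : \sum_(i in P) \sum_(j in P) f j ^+ 2 =
    #|P|%:R * \sum_(i in P) f i ^+ 2 by rewrite exchange_big.
have -> : #|P|%:R * \sum_(i in P) f i ^+ 2 =
    \sum_(i in P) \sum_(j in P) (f i ^+ 2 + f j ^+ 2) / 2.
  under [RHS]eq_bigr do rewrite -mulr_suml big_split /=.
  rewrite -mulr_suml big_split /= E1 E2 -mulr2n -[_ *+ 2]mulr_natr mulfK //.
  by rewrite pnatr_eq0.
rewrite expr2 mulr_suml; apply: ler_sum => i _.
rewrite mulr_sumr; apply: ler_sum => j _.
rewrite ler_pdivlMr ?ltr0n // mulr_natr -subr_ge0.
have -> : f i ^+ 2 + f j ^+ 2 - f i * f j *+ 2 = (f i - f j) ^+ 2.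
  by rewrite sqrrB addrAC.
exact: sqr_ge0.
Qed.

(** * Eigenvalues and the spectral norm of symmetric matrices *)

(** Over [R[i]] the matrix is hermitian, hence unitarily diagonalizable. Its trace is the sum of [n]
    real eigenvalues, each a root over [R] of the characteristic polynomial of [A]. *)
Lemma mxtrace_sym_le (R : rcfType) (n : nat) (A : 'M[R]_n) (b : R) :
  A^T = A -> (forall a, eigenvalue A a -> a <= b) -> \tr A <= n%:R * b.
Proof.
move=> sA leb; pose C := [the numClosedFieldType of R[i]].
pose f := @real_complex R : {rmorphism R -> C}.
pose B : 'M[C]_n := map_mx f A.
have hB : B \is hermsymmx.
  apply/is_hermitianmxP; rewrite expr0 scale1r; apply/matrixP => i j.
  rewrite !mxE -[in LHS]sA mxE; apply/eqP.
  by rewrite /f /= eq_complex /= oppr0 !eqxx.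
have eB : B = invmx (spectralmx B) *m diag_mx (spectral_diag B) *m spectralmx B.
  exact/orthomx_spectralP/hermitian_normalmx.
have uP := spectral_unit B.
set P := spectralmx B in eB uP; set sp := spectral_diag B in eB.
have spE i : exists2 x : R, sp 0 i = f x & x <= b.
  have rsp : sp 0 i \is Num.real.
    by have /mxOverP := hermitian_spectral_diag_real hB; apply.
  have {}rsp : sp 0 i = f (complex.Re (sp 0 i)).
    by rewrite /f /= RRe_real.
  exists (complex.Re (sp 0 i)) => //; apply: leb.
  rewrite eigenvalue_root_char -(fmorph_root f) map_char_poly -rsp.
  rewrite -eigenvalue_root_char; apply/eigenvalueP.
  (* Row [i] of [P] is a left eigenvector for [sp 0 i]. *)
  exists (delta_mx 0 i *m P).
    rewrite -/B eB !mulmxA mulmxK // scalemxAl; congr (_ *m P).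
    apply/rowP => j; rewrite mul_mx_diag !mxE eqxx /=.
    by case: eqP => [->|]; rewrite ?mulr1 ?mul1r ?mul0r ?mulr0.
  apply/eqP => /(congr1 (mulmx^~ (invmx P))); rewrite mulmxK // mul0mx.
  by move/rowP/(_ i)/eqP; rewrite !mxE !eqxx oner_eq0.
have : \tr B = \sum_i sp 0 i.
  by rewrite eB -mulmxA mxtrace_mulC -mulmxA mulmxV // mulmx1 mxtrace_diag.
rewrite trace_map_mx => /(congr1 (@complex.Re R)) /= ->.
have [x xE xb] := fin_all_exists2 spE.
under eq_bigr do rewrite xE.
rewrite -rmorph_sum /=; apply: le_trans (ler_sum _ (fun i _ => xb i)) _.
by rewrite sumr_const card_ord mulr_natl.
Qed.

Lemma spectral_norm_sqr_le (R : realType) (m n : nat) (A : 'M[R]_(m, n))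
    (b : R) :
  0 <= b -> (forall s, singular_value A s -> s ^+ 2 <= b) ->
  spectral_norm A ^+ 2 <= b.
Proof.
move=> b0 leb.
have ub : ubound [set s | singular_value A s]%classic (Num.sqrt b).
  move=> s As; have /leb sb := As; have [s0 _] := As.
  by rewrite -(ger0_norm s0) -sqrtr_sqr ler_wsqrtr.
suff : 0 <= spectral_norm A <= Num.sqrt b.
  case/andP=> s0 sb; rewrite -(sqr_sqrtr b0).
  by rewrite ler_sqr ?nnegrE ?sqrtr_ge0.
rewrite /spectral_norm.
(* Without singular values, as for a matrix with no columns, the norm is 0, the value of [sup] on
   the empty set. *)
have [->|/set0P[s As]] := eqVneq [set s | singular_value A s]%classic set0.
  by rewrite sup0 lexx sqrtr_ge0.
apply/andP; split; last by apply: ge_sup => //; exists s.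
apply: le_trans (_ : s <= _); first by case: As.
by apply: ub_le_sup => //; exists (Num.sqrt b).
Qed.

(* The l^oo operator norm dominates the moduli of the eigenvalues. *)
Lemma singular_value_le_row_sum (R : realType) (n : nat) (B : 'M[R]_n)
    (b s : R) :
  B^T = B -> (forall i, \sum_j `|B i j| <= b) -> singular_value B s -> s <= b.
Proof.
move=> sB leb [s0 /eigenvalueP[v vB /rV0Pn[i0 vi0]]].
have b0 : 0 <= b by apply: le_trans (leb i0); apply: sumr_ge0.
have step (w : 'rV[R]_n) (c : R) : (forall j, `|w 0 j| <= c) ->
    forall j, `|(w *m B) 0 j| <= c * b.
  move=> wc j; have c0 : 0 <= c by apply: le_trans (wc j).
  rewrite mxE; apply: le_trans (ler_norm_sum _ _ _) _.
  apply: le_trans (_ : c * \sum_i `|B j i| <= _); last exact: ler_wpM2l.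
  rewrite mulr_sumr; apply: ler_sum => i _.
  by rewrite normrM -[in `|B i j|]sB mxE ler_wpM2r.
have [i1 _ i1max] := @arg_maxP _ _ _ i0 predT (fun i => `|v 0 i|) isT.
have vmax j : `|v 0 j| <= `|v 0 i1| by exact: i1max.
have v1 : 0 < `|v 0 i1|.
  by apply: lt_le_trans (vmax i0); rewrite normr_gt0.
(* By symmetry [s^2] is an eigenvalue of [B *m B]; two steps at the largest coordinate give
   [s^2 |v i1| <= |v i1| b^2]. *)
have /(_ i1) := step _ _ (step _ _ vmax).
rewrite -mulmxA -[X in X *m B]sB vB mxE normrM ger0_norm ?sqr_ge0 //.
rewrite -mulrA mulrC ler_pM2l // -expr2.
by rewrite ler_sqr ?nnegrE.
Qed.

Lemma singular_value_sqr_le (R : realType) (n : nat) (B : 'M[R]_n) (b s : R) :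
  B^T = B -> (forall i, (\sum_j `|B i j|) ^+ 2 <= b) ->
  singular_value B s -> s ^+ 2 <= b.
Proof.
move=> sB leb Bs; have [s0 /eigenvalueP[v _ /rV0Pn[i0 _]]] := Bs.
have b0 : 0 <= b by apply: le_trans (leb i0); apply: sqr_ge0.
rewrite -(sqr_sqrtr b0) ler_sqr ?nnegrE ?sqrtr_ge0 //.
apply: singular_value_le_row_sum Bs => // i.
rewrite -[leLHS]ger0_norm ?sumr_ge0 // -sqrtr_sqr; exact: ler_wsqrtr.
Qed.

Lemma mxtrace_trmx_mul (R : comNzRingType) (m n : nat) (A : 'M[R]_(m, n)) :
  \tr (A^T *m A) = \sum_i \sum_j A i j ^+ 2.
Proof.
rewrite /mxtrace exchange_big; apply: eq_bigr => j _; rewrite mxE.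
by apply: eq_bigr => i _; rewrite mxE expr2.
Qed.

(** The left side is the trace of [B^T *m B], whose eigenvalues are nonnegative and have singular
    values of [B] as square roots. *)
Lemma frobenius_le_spectral_norm (R : realType) (n : nat) (B : 'M[R]_n) :
  B^T = B -> \sum_i \sum_j B i j ^+ 2 <= n%:R * spectral_norm B ^+ 2.
Proof.
move=> sB; rewrite -mxtrace_trmx_mul; apply: mxtrace_sym_le.
  by rewrite trmx_mul trmxK.
move=> a /[dup] Ba /eigenvalueP[v vB v0].
have norm_ge0 (w : 'rV[R]_n) : 0 <= (w *m w^T) 0 0.
  by rewrite mxE sumr_ge0 // => i _; rewrite mxE -expr2 sqr_ge0.
have a0 : 0 <= a.
  have : 0 <= a * (v *m v^T) 0 0.
    suff -> : a * (v *m v^T) 0 0 = ((v *m B) *m (v *m B)^T) 0 0 by [].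
    by rewrite trmx_mul mulmxA -[v *m B *m _]mulmxA -[in B *m B^T]sB trmxK vB
         -scalemxAl [in RHS]mxE.
  rewrite pmulr_lge0 // lt0r norm_ge0 andbT; apply: contraNneq v0.
  rewrite mxE => /psumr_eq0P v00; apply/eqP/rowP => i.
  have /eqP := v00 (fun i _ => ltac:(rewrite mxE -expr2; exact: sqr_ge0)) i isT.
  by rewrite !mxE -expr2 sqrf_eq0 => /eqP.
have as_le : Num.sqrt a <= spectral_norm B.
  apply: ub_le_sup; last first.
    by split; rewrite ?sqrtr_ge0 // sqr_sqrtr.
  (* The sum of all moduli dominates every row sum, so the singular values are bounded above. *)
  exists (\sum_i \sum_j `|B i j|) => s /singular_value_le_row_sum; apply=> // i.
  by rewrite [leRHS](bigD1 i) //= lerDl; do 2!apply: sumr_ge0 => ? _.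
rewrite -(sqr_sqrtr a0) ler_sqr ?nnegrE ?sqrtr_ge0 //; last first.
  exact: le_trans (sqrtr_ge0 a) as_le.
Qed.

(** * Comparison of the two Gram matrices *)

Lemma trmx_gram_sub1 (R : comNzRingType) (m n : nat) (A : 'M[R]_(m, n)) :
  (A^T *m A - 1%:M)^T = A^T *m A - 1%:M.
Proof. by rewrite linearB /= trmx_mul trmxK trmx1. Qed.

(** Since [A F = E A], an eigenvector [v] of [E^2] is carried to [v A]. If [v A = 0], then [s^2 = 1]
    and the square matrix [A] is singular; a nonzero [u] with [u A^T = 0] satisfies [u F = - u] and
    serves instead. *)
Lemma singular_value_gram_swap (R : realType) (m n : nat) (A : 'M[R]_(m, n))
    (s : R) :
  m = n -> singular_value (A *m A^T - 1%:M) s ->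
  singular_value (A^T *m A - 1%:M) s.
Proof.
move=> mn [s0 /eigenvalueP[v vE v0]]; split=> //.
set E := A *m A^T - 1%:M in vE; set F := A^T *m A - 1%:M.
have tE : E^T = E by have := trmx_gram_sub1 A^T; rewrite trmxK.
rewrite tE in vE; rewrite trmx_gram_sub1 -/F.
have AF : A *m F = E *m A by rewrite mulmxBl mulmxBr mul1mx mulmx1 mulmxA.
have [vA0|vA0] := eqVneq (v *m A) 0; last first.
  apply/eigenvalueP; exists (v *m A) => //.
  by rewrite mulmxA -(mulmxA v) AF -!mulmxA AF !mulmxA -(mulmxA v) vE scalemxAl.
have s1 : s ^+ 2 = 1.
  have vEN : v *m E = - v by rewrite mulmxBr mulmxA vA0 mul0mx mulmx1 sub0r.
  move: vE; rewrite mulmxA vEN mulNmx vEN opprK => /eqP.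
  rewrite -subr_eq0 -{1}[v]scale1r -scalerBl scaler_eq0 (negPf v0) orbF.
  by rewrite subr_eq0 => /eqP.
have : kermx A^T != 0.
  rewrite kermx_eq0; apply: contraNN v0; rewrite /row_free mxrank_tr => /eqP rA.
  have frA : row_free A by rewrite /row_free rA mn.
  by apply/eqP/(row_free_inj frA); rewrite vA0 mul0mx.
case/rowV0Pn=> u /sub_kermxP uA u0; apply/eigenvalueP; exists u => //.
have uFN : u *m F = - u by rewrite mulmxBr mulmxA uA mul0mx mulmx1 sub0r.
by rewrite mulmxA uFN mulNmx uFN opprK s1 scale1r.
Qed.

(** Each squared norm is [tr (H^2) - 2 tr H] plus the size, where [H] is the Gram matrix; both
    traces are the same for the two Gram matrices. *)
Lemma sum_sqr_gram_swap (R : comNzRingType) (m n : nat) (A : 'M[R]_(m, n)) :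
  \sum_i \sum_j (A^T *m A - 1%:M) i j ^+ 2 + m%:R =
  \sum_i \sum_j (A *m A^T - 1%:M) i j ^+ 2 + n%:R.
Proof.
have trsq p q (B : 'M[R]_(p, q)) : \sum_i \sum_j (B^T *m B - 1%:M) i j ^+ 2 =
    \tr (B^T *m B *m (B^T *m B)) - \tr (B^T *m B) *+ 2 + q%:R.
  rewrite -mxtrace_trmx_mul trmx_gram_sub1 mulmxBl !mulmxBr !mul1mx mulmx1.
  by rewrite !linearB /= mxtrace1 mulr2n !opprB addrA addrAC opprD !addrA.
have := trsq _ _ A^T; rewrite !trmxK trsq => ->.
have -> : \tr (A^T *m A *m (A^T *m A)) = \tr (A *m A^T *m (A *m A^T)).
  by rewrite -mulmxA mxtrace_mulC !mulmxA.
by rewrite (mxtrace_mulC A^T A) addrAC.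
Qed.

(** * Periodic grids and zero padding *)

Lemma wrap_subproof (n : nat) (a : int) :
  (0 < n)%N -> (`|(a %% n%:Z)%Z| < n)%N.
Proof.
by move=> n0; rewrite -ltz_nat abszE ger0_norm ?modz_ge0 ?ltz_pmod //; lia.
Qed.

Definition wrap (n : nat) (n0 : (0 < n)%N) (a : int) : 'I_n :=
  Ordinal (wrap_subproof a n0).

Lemma wrapE (n : nat) (n0 : (0 < n)%N) (a : int) :
  (wrap n0 a)%:Z = (a %% n%:Z)%Z.
Proof. by rewrite /= abszE ger0_norm ?modz_ge0 //; lia. Qed.

Lemma eq_wrap (n : nat) (n0 : (0 < n)%N) (a : int) (j : 'I_n) :
  (wrap n0 a == j) = (n%:Z %| a - j%:Z)%Z.
Proof.
rewrite -eqz_mod_dvd -wrapE (modz_small (_ : 0 <= j%:Z < n%:Z)); last first.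
  by have := ltn_ord j; lia.
by rewrite eqz_nat.
Qed.

Definition gwrap (d n : nat) (n0 : (0 < n)%N) (p : 'I_d -> int) : grid d n :=
  [ffun s => wrap n0 (p s)].

Lemma gwrap_eq (d n : nat) (n0 : (0 < n)%N) (p : 'I_d -> int) (g : grid d n) :
  (gwrap n0 p == g) = [forall s, (n%:Z %| p s - (g s)%:Z)%Z].
Proof.
apply/eqP/forallP => [<- s|pg]; first by rewrite ffunE -eq_wrap.
by apply/ffunP => s; rewrite ffunE; apply/eqP; rewrite eq_wrap.
Qed.

Lemma gwrap_eqmod (d n : nat) (n0 : (0 < n)%N) (p p' : 'I_d -> int) :
  (gwrap n0 p == gwrap n0 p') = [forall s, (n%:Z %| p s - p' s)%Z].
Proof.
rewrite gwrap_eq; apply: eq_forallb => s.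
by rewrite ffunE wrapE -!eqz_mod_dvd modz_mod.
Qed.

Lemma gwrap_id (d n : nat) (n0 : (0 < n)%N) (g : grid d n) :
  gwrap n0 (fun s => (g s)%:Z) = g.
Proof. by apply/eqP; rewrite gwrap_eq; apply/forallP => s; rewrite subrr. Qed.

(** As a sum with at most one nonzero term, the padded value can be carried through exchanges of
    summation. *)
Lemma entryE (R : realType) (d n : nat) (t : grid d n -> R) (p : 'I_d -> int) :
  entry t p = \sum_(q : grid d n) t q * [forall s, (q s)%:Z == p s]%:R.
Proof.
rewrite /entry; case: pickP => [q /forallP qp|np]; last first.
  by rewrite big1 // => q _; rewrite np mulr0.
rewrite (bigD1 q) //= (introT forallP qp) mulr1 big1 ?addr0 // => q' /eqP q'q.
case: forallP => [q'p|]; last by rewrite mulr0.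
case: q'q; apply/ffunP => s; apply/val_inj/eqP.
by rewrite -eqz_nat (eqP (q'p s)) -(eqP (qp s)).
Qed.

Lemma entry_modz (R : realType) (d n : nat) (n0 : (0 < n)%N)
    (t : grid d n -> R) (p : 'I_d -> int) :
  entry t (fun s => (p s %% n%:Z)%Z) = t (gwrap n0 p).
Proof.
have pP s : (gwrap n0 p s)%:Z == (p s %% n%:Z)%Z by rewrite ffunE wrapE.
rewrite entryE (bigD1 (gwrap n0 p)) //= (introT forallP pP) mulr1.
rewrite big1 ?addr0 // => q /eqP qp.
case: forallP => [qE|]; last by rewrite mulr0.
case: qp; apply/ffunP => s; apply/val_inj/eqP.
by rewrite ffunE -eqz_nat wrapE (eqP (qE s)).
Qed.

Lemma sum_eq_indic (R : pzSemiRingType) (T : finType) (x : T) :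
  \sum_y (x == y)%:R = 1 :> R.
Proof.
rewrite (bigD1 x) //= eqxx big1 ?addr0 // => y /negPf.
by rewrite eq_sym => ->.
Qed.

Lemma tsizeE (k S : nat) : (0 < S)%N -> tsize k S = (2 * ((k - 1) %/ S) + 1)%N.
Proof. by move=> S0; rewrite /padding mulnA mulnK. Qed.

Lemma paddingK (k S : nat) :
  (0 < S)%N -> (padding k S %/ S)%N = ((k - 1) %/ S)%N.
Proof. by move=> S0; rewrite /padding mulnK. Qed.

Lemma sum_inj_le (R : numDomainType) (I T : finType) (h : I -> T) (f : T -> R) :
  injective h -> (forall y, 0 <= f y) -> \sum_a f (h a) <= \sum_y f y.
Proof.
move=> hI f0; rewrite [leRHS](bigID (mem [set h a | a in predT])) /=.
rewrite big_imset /=; last by move=> ? ? _ _; apply: hI.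
by rewrite lerDl sumr_ge0.
Qed.

(** At most one term is nonzero, so squaring creates no cross terms. *)
Lemma sqr_sum_inj_indic (R : pzSemiRingType) (I T : finType) (h : I -> T)
    (f : I -> R) (y : T) :
  injective h ->
  (\sum_a f a * (h a == y)%:R) ^+ 2 = \sum_a f a ^+ 2 * (h a == y)%:R.
Proof.
move=> hI; have [/codomP[a ->]|yh] := boolP (y \in codom h).
  rewrite (bigD1 a) //= [in RHS](bigD1 a) //= eqxx !mulr1.
  rewrite !big1 ?addr0 // => b /negPf;
    by rewrite (inj_eq hI) => ->; rewrite mulr0.
have hy a : (h a == y) = false by apply: contraNF yh => /eqP <-; apply: codom_f.
by rewrite !big1 ?expr0n // => a _; rewrite hy mulr0.
Qed.

(** * The Gram matrix [A *m A^T] in terms of the autocorrelation *)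

Section Layer.
Variables (R : realType) (d M C k S N : nat).
Variable K : 'I_M -> 'I_C -> grid d k -> R.
Hypotheses (S0 : (0 < S)%N) (N0 : (0 < N)%N).

Let SN0 : (0 < S * N)%N. Proof. by rewrite muln_gt0 S0. Qed.
Let A := layer_mx S N K.
Let q := ((k - 1) %/ S)%N.
Let D m l (n : grid d (tsize k S)) := autocorr K m l n - Ir0 R m l n.

Definition input_pos (i : grid d N) (a : grid d k) : grid d (S * N) :=
  gwrap SN0 (fun s => (a s)%:Z + S%:Z * (i s)%:Z - (k./2)%:Z).

(* [n] indexes the third axis of T, whose center [q] is the zero offset. *)
Definition lag (i : grid d N) (n : grid d (tsize k S)) : grid d N :=
  gwrap N0 (fun s => (i s)%:Z + q%:Z - (n s)%:Z).

Lemma layer_mxE p r :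
  A p r = \sum_a K (enum_val p).1 (enum_val r).1 a *
                 (input_pos (enum_val p).2 a == (enum_val r).2)%:R.
Proof.
rewrite mxE /conv; case: (enum_val p) (enum_val r) => m i [c x] /=.
rewrite (bigD1 c) //= [X in _ + X]big1 ?addr0.
  by apply: eq_bigr => a _; rewrite (entry_modz SN0) xpair_eqE eqxx.
move=> c' /negPf c'c; apply: big1 => a _.
by rewrite (entry_modz SN0) xpair_eqE c'c mulr0.
Qed.

(** Division by [S] gives [b - a = S u] with [u = i - j - t N]. As [|b - a| <= k - 1], [|u| <= q],
    and the index sought is [u + q]. *)
Lemma lag_witness (i j : 'I_N) (a b : 'I_k) (r : int) :
  ((S * N)%N%:Z %| (a%:Z + S%:Z * i%:Z - r) - (b%:Z + S%:Z * j%:Z - r))%Z ->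
  exists n : 'I_(tsize k S),
    b%:Z = a%:Z + S%:Z * n%:Z - (padding k S)%:Z /\
    (N%:Z %| i%:Z + q%:Z - n%:Z - j%:Z)%Z.
Proof.
case/dvdzP => t; rewrite PoszM => tE.
pose u : int := i%:Z - j%:Z - t * N%:Z.
have bE : b%:Z - a%:Z = S%:Z * u.
  rewrite /u !mulrBr (mulrCA _ t) -tE; ring.
have uq : (`|u| <= q)%N.
  rewrite leq_divRL // mulnC -[S]absz_nat -abszM -bE.
  by have := ltn_ord a; have := ltn_ord b; lia.
have nP : (`|(u + q%:Z)%R| < tsize k S)%N by rewrite tsizeE // -/q; lia.
exists (Ordinal nP).
have -> : (Ordinal nP)%:Z = u + q%:Z by rewrite /= gez0_abs //; lia.
split; first by rewrite /padding -/q PoszM mulrDr -bE; ring.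
by apply/dvdzP; exists t; rewrite /u; ring.
Qed.

Lemma lag_cancel (i j : 'I_N) (a b : 'I_k) (n : 'I_(tsize k S)) (r : int) :
  b%:Z = a%:Z + S%:Z * n%:Z - (padding k S)%:Z ->
  (N%:Z %| i%:Z + q%:Z - n%:Z - j%:Z)%Z ->
  ((S * N)%N%:Z %| (a%:Z + S%:Z * i%:Z - r) - (b%:Z + S%:Z * j%:Z - r))%Z.
Proof.
move=> -> /dvdzP[t tE]; apply/dvdzP; exists t.
rewrite PoszM mulrCA -tE /padding -/q PoszM; ring.
Qed.

(** When the two input positions agree, exactly one [n] contributes: it exists coordinatewise, and
    [a] and [b] determine [S n]. Conversely, any contributing [n] forces agreement. *)
Lemma input_pos_eq_lag i j a b :
  (input_pos i a == input_pos j b)%:R =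
  \sum_(n : grid d (tsize k S))
    [forall s, (b s)%:Z ==
       (a s)%:Z + S%:Z * (n s)%:Z - (padding k S)%:Z]%:R *
    (lag i n == j)%:R :> R.
Proof.
rewrite gwrap_eqmod.
under eq_bigr do rewrite -natrM mulnb gwrap_eq.
case: forallP => [ij|nij].
  have [f fP] := fin_all_exists (fun s => lag_witness (ij s)).
  pose n : grid d (tsize k S) := [ffun s => f s].
  have bE s : (b s)%:Z == (a s)%:Z + S%:Z * (n s)%:Z - (padding k S)%:Z.
    by rewrite ffunE; apply/eqP; case: (fP s).
  have iE s : (N%:Z %| (i s)%:Z + q%:Z - (n s)%:Z - (j s)%:Z)%Z.
    by rewrite ffunE; case: (fP s).
  rewrite (bigD1 n) //= (introT forallP bE) (introT forallP iE) /=.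
  rewrite big1 ?addr0 // => n' /eqP n'n; case: forallP => //= bE'; case: n'n.
  apply/ffunP => s; apply/val_inj/eqP.
  rewrite -eqz_nat -(inj_eq (mulfI (_ : S%:Z != 0))); last by lia.
  have := bE s; rewrite (eqP (bE' s)) -!addrA.
  by rewrite (inj_eq (addrI _)) (inj_eq (addIr _)).
rewrite big1 // => n _; case: forallP => //= bE; case: forallP => //= iE.
by case: nij => s; apply: lag_cancel (iE s); apply/eqP.
Qed.

Lemma gram_lag p r :
  (A *m A^T) p r = \sum_n autocorr K (enum_val p).1 (enum_val r).1 n *
                          (lag (enum_val p).2 n == (enum_val r).2)%:R.
Proof.
rewrite mxE.
under eq_bigr do rewrite [A^T _ _]mxE !layer_mxE.
case: (enum_val p) (enum_val r) => m i [l j] /=.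
pose F c x := (\sum_a K m c a * (input_pos i a == x)%:R) *
  (\sum_b K l c b * (input_pos j b == x)%:R).
rewrite (sum_enum_val (fun y => F y.1 y.2)) -(pair_bigA _ F) /= /F.
under [RHS]eq_bigr do rewrite mulr_suml.
rewrite [RHS]exchange_big /=; apply: eq_bigr => c _.
under [RHS]eq_bigr do rewrite mulr_suml.
rewrite [RHS]exchange_big /=.
under eq_bigr do rewrite mulr_suml.
rewrite exchange_big /=; apply: eq_bigr => a _.
(* Summed over input positions, the product of the two indicators leaves the condition that both
   positions coincide. *)
transitivity (\sum_b K m c a * K l c b * (input_pos i a == input_pos j b)%:R).
  under eq_bigr do rewrite mulr_sumr.
  rewrite exchange_big /=; apply: eq_bigr => b _.
  under eq_bigr do rewrite mulrACA.
  rewrite -mulr_sumr; congr (_ * _).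
  rewrite (bigD1 (input_pos i a)) //= eqxx mul1r big1 ?addr0.
    by rewrite eq_sym.
  by move=> x /negPf; rewrite eq_sym => ->; rewrite mul0r.
under [RHS]eq_bigr do rewrite entryE mulr_sumr mulr_suml.
rewrite [RHS]exchange_big /=; apply: eq_bigr => b _.
rewrite input_pos_eq_lag mulr_sumr; apply: eq_bigr => n _.
by rewrite !mulrA.
Qed.

(** The identity matrix is the contribution of [Ir0], whose only nonzero spatial index is the
    center, where [lag] is the identity. *)
Lemma gram_sub1_lag p r :
  (A *m A^T - 1%:M) p r = \sum_n D (enum_val p).1 (enum_val r).1 n *
                          (lag (enum_val p).2 n == (enum_val r).2)%:R.
Proof.
rewrite [LHS]mxE gram_lag 2!mxE /D.
under [RHS]eq_bigr do rewrite mulrBl.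
rewrite sumrB; congr (_ - _); rewrite -(inj_eq enum_val_inj).
case: (enum_val p) (enum_val r) => m i [l j] /=.
have qP : (q < tsize k S)%N by rewrite tsizeE // -/q; lia.
rewrite (bigD1 [ffun=> Ordinal qP]) //= big1 ?addr0 => [|n /eqP nq].
  rewrite xpair_eqE /Ir0 (introT forallP (_ : forall s, _)); last first.
    by move=> s; rewrite ffunE /= paddingK.
  rewrite andbT -natrM mulnb gwrap_eq; congr (_ && _)%:R.
  apply/eqP/forallP => [-> s|ij]; first by rewrite ffunE /= addrK subrr.
  have /eqP <- : gwrap N0 (fun s => (i s)%:Z) == j.
    rewrite gwrap_eq; apply/forallP => s; have := ij s.
    by rewrite ffunE /= addrK.
  by rewrite gwrap_id.
rewrite /Ir0; case: forallP => [nE|]; last by rewrite andbF mul0r.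
case: nq; apply/ffunP => s; apply/val_inj; rewrite ffunE /=.
by rewrite (eqP (nE s)) paddingK.
Qed.

Let L2 := \sum_m \sum_l \sum_n D m l n ^+ 2.

Lemma Lorth_ROE : Lorth RO S K = L2.
Proof.
rewrite /Lorth /frobenius sqr_sqrtr //.
by do 3!apply: sumr_ge0 => ? _; apply: sqr_ge0.
Qed.

(** Each [D m l n] enters a single column of row [p], so the row sum is at most a sum of
    [M (2q+1)^d] moduli; Cauchy-Schwarz applies to it. *)
Lemma gram_row_sum_sqr_le p :
  (\sum_r `|(A *m A^T - 1%:M) p r|) ^+ 2 <= alpha R RO d M C k S * L2.
Proof.
set m := (enum_val p).1.
have le1 : \sum_r `|(A *m A^T - 1%:M) p r| <= \sum_y `|D m y.1 y.2|.
  under eq_bigr do rewrite gram_sub1_lag.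
  pose F l j := `|\sum_n D m l n * (lag (enum_val p).2 n == j)%:R|.
  rewrite (sum_enum_val (fun y => F y.1 y.2)) -(pair_bigA _ F) /=.
  rewrite -(pair_bigA _ (fun l n => `|D m l n|)) /=; apply: ler_sum => l _.
  apply: le_trans (ler_sum _ (fun j _ => ler_norm_sum _ _ _)) _.
  rewrite exchange_big /=; apply: ler_sum => n _.
  under eq_bigr do rewrite normrM normr_nat.
  by rewrite -mulr_sumr sum_eq_indic mulr1.
apply: le_trans (_ : (\sum_y `|D m y.1 y.2|) ^+ 2 <= _).
  by rewrite ler_sqr ?nnegrE ?sumr_ge0.
apply: le_trans (sqr_sum_le_card _ _) _.
have -> : alpha R RO d M C k S = #|{: 'I_M * grid d (tsize k S)}|%:R.
  by rewrite card_prod card_ffun !card_ord /alpha tsizeE // mulnC.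
apply: ler_wpM2l; first by rewrite ler0n.
under eq_bigr do rewrite real_normK ?num_real //.
rewrite -(pair_bigA _ (fun l n => D m l n ^+ 2)) /L2 [leRHS](bigD1 m) //= lerDl.
by do 3!apply: sumr_ge0 => ? _; apply: sqr_ge0.
Qed.


Hypotheses (k0 : (0 < k)%N) (kSN : (2 * k - 1 <= S * N)%N).

(** From [S q <= k - 1] and [2k - 1 <= S N] follows [2q < N], so the [2q+1] offsets per axis stay
    distinct modulo [N]. *)
Lemma lag_inj i : injective (lag i).
Proof.
have qN : (2 * q < N)%N.
  rewrite -(ltn_pmul2l S0); have := leq_trunc_div (k - 1) S; rewrite -/q; nia.
move=> n n' /eqP; rewrite gwrap_eqmod => /forallP nn'.
apply/ffunP => s; apply/val_inj/eqP => /=.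
have nN (m : grid d (tsize k S)) : (m s < N)%N.
  by have := ltn_ord (m s); rewrite [X in (_ < X)%N]tsizeE // -/q; lia.
rewrite -(modn_small (nN n)) -(modn_small (nN n')) -eqz_nat -!modz_nat.
rewrite eq_sym eqz_mod_dvd.
by have := nn' s; congr (_ %| _)%Z; ring.
Qed.

Lemma sum_sqr_gram :
  \sum_p \sum_r (A *m A^T - 1%:M) p r ^+ 2 = (N ^ d)%:R * L2.
Proof.
under eq_bigr do under eq_bigr do
  rewrite gram_sub1_lag (sqr_sum_inj_indic _ _ (@lag_inj _)).
pose F m i l (j : grid d N) := \sum_n D m l n ^+ 2 * (lag i n == j)%:R.
pose H m i :=
  \sum_(r < #|{: 'I_M * grid d N}|) F m i (enum_val r).1 (enum_val r).2.
rewrite (sum_enum_val (fun x => H x.1 x.2)) -(pair_bigA _ H) /=.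
rewrite /L2 mulr_sumr; apply: eq_bigr => m _.
transitivity (\sum_(i : grid d N) \sum_l \sum_n D m l n ^+ 2); last first.
  by rewrite sumr_const card_ffun !card_ord mulr_natl.
apply: eq_bigr => i _.
rewrite /H (sum_enum_val (fun y => F m i y.1 y.2)) -(pair_bigA _ (F m i)) /=.
apply: eq_bigr => l _; rewrite exchange_big /=; apply: eq_bigr => n _.
by rewrite -mulr_sumr sum_eq_indic mulr1.
Qed.

(** * The Gram matrix [A^T *m A]: translation invariance and support *)

(** [B] and [G] are the entries of [A] and [A^T *m A - 1%:M], indexed by channel and position
    instead of ranks in [enum]. *)
Let B m i (y : 'I_C * grid d (S * N)) : R :=
  \sum_a K m y.1 a * (input_pos i a == y.2)%:R.
Let G y z := \sum_m \sum_i B m i y * B m i z - (y == z)%:R.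

Lemma gramT_sub1E p r : (A^T *m A - 1%:M) p r = G (enum_val p) (enum_val r).
Proof.
rewrite [LHS]mxE [X in X + _]mxE 2!mxE -(inj_eq enum_val_inj); congr (_ - _).
under eq_bigr do rewrite [A^T _ _]mxE !layer_mxE.
pose F m i := B m i (enum_val p) * B m i (enum_val r).
by rewrite (sum_enum_val (fun x => F x.1 x.2)) pair_bigA.
Qed.

(** The correction [M - C S^d] in [Lorth CO] is the difference of the two matrix sizes divided by
    [N^d]. *)
Lemma sum_sqr_gramT :
  \sum_p \sum_r (A^T *m A - 1%:M) p r ^+ 2 = (N ^ d)%:R * Lorth CO S K.
Proof.
have := sum_sqr_gram_swap A; rewrite sum_sqr_gram => /(canRL (addrK _)) ->.
rewrite !card_prod !card_ffun !card_ord.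
have -> : Lorth CO S K = L2 - (M%:R - (C * S ^ d)%:R) by rewrite -Lorth_ROE.
rewrite expnMn !natrM; ring.
Qed.

Lemma sum_sqr_gramT_pairs :
  \sum_y \sum_z G y z ^+ 2 = (N ^ d)%:R * Lorth CO S K.
Proof.
rewrite -sum_sqr_gramT.
under [RHS]eq_bigr do under eq_bigr do rewrite gramT_sub1E.
rewrite (sum_enum_val (fun y => \sum_r G y (enum_val r) ^+ 2)).
by apply: eq_bigr => y _; rewrite (sum_enum_val (fun z => G y z ^+ 2)).
Qed.

(* Translating the output by [a] translates the input by [S * a]. *)
Let shift_out (a i : grid d N) : grid d N :=
  gwrap N0 (fun s => (i s)%:Z + (a s)%:Z).
Let shift_in (a : grid d N) (x : grid d (S * N)) : grid d (S * N) :=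
  gwrap SN0 (fun s => (x s)%:Z + S%:Z * (a s)%:Z).

Lemma shift_out_inj a : injective (shift_out a).
Proof.
move=> i j /eqP; rewrite gwrap_eqmod => /forallP ij.
apply/eqP; rewrite -(gwrap_id N0 i).
by rewrite gwrap_eq; apply/forallP => s; have := ij s; congr (_ %| _)%Z; ring.
Qed.

Lemma shift_in_inj a : injective (shift_in a).
Proof.
move=> i j /eqP; rewrite gwrap_eqmod => /forallP ij.
apply/eqP; rewrite -(gwrap_id SN0 i).
by rewrite gwrap_eq; apply/forallP => s; have := ij s; congr (_ %| _)%Z; ring.
Qed.

Lemma shift_in_injl x : injective (shift_in^~ x).
Proof.
move=> a b /eqP; rewrite gwrap_eqmod => /forallP ab.
apply/eqP; rewrite -(gwrap_id N0 a).
rewrite gwrap_eq; apply/forallP => s; have := ab s.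
rewrite (_ : _ - _ = S%:Z * ((a s)%:Z - (b s)%:Z)); last by ring.
by rewrite PoszM dvdz_mul2l //; lia.
Qed.

(** Reducing [i + a] modulo [N] removes a multiple [t N], which the stride turns into a multiple of
    the input period [S N]. *)
Lemma kernel_shift a m i c x :
  B m (shift_out a i) (c, shift_in a x) = B m i (c, x).
Proof.
apply: eq_bigr => b _ /=; congr (_ * (nat_of_bool _)%:R).
rewrite gwrap_eqmod gwrap_eq; apply: eq_forallb => s; rewrite ffunE wrapE.
have iaE := divz_eq ((i s)%:Z + (a s)%:Z) N%:Z.
set t := ((_ + _) %/ _)%Z in iaE.
rewrite -[RHS](rpredBr (x := t * (S * N)%N%:Z)) ?dvdz_mull //.
rewrite PoszM; congr (_ %| _)%Z.
have -> : (((i s)%:Z + (a s)%:Z) %% N%:Z)%Z = (i s)%:Z + (a s)%:Z - t * N%:Z.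
  by apply: (addrI (t * N%:Z)); rewrite -iaE; ring.
by ring.
Qed.

Lemma gramT_shift a c x c' x' :
  G (c, shift_in a x) (c', shift_in a x') = G (c, x) (c', x').
Proof.
rewrite /G !xpair_eqE (inj_eq (@shift_in_inj a)); congr (_ - _).
apply: eq_bigr => m _; rewrite (reindex_inj (@shift_out_inj a)) /=.
by apply: eq_bigr => i _; rewrite !kernel_shift.
Qed.

(** The [N^d] translates of row [y] are distinct rows of equal norm, and all rows together have
    squared norm [N^d] times the right side. *)
Lemma gramT_row_sqr_le y : \sum_z G y z ^+ 2 <= Lorth CO S K.
Proof.
have Nd0 : 0 < (N ^ d)%:R :> R by rewrite ltr0n expn_gt0 N0.
rewrite -(ler_pM2l Nd0) -sum_sqr_gramT_pairs; case: y => c x.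
apply: le_trans (sum_inj_le (h := fun a => (c, shift_in a x)) _ _).
- rewrite le_eqVlt; apply/orP/or_introl/eqP.
  transitivity (\sum_(a : grid d N) \sum_z G (c, x) z ^+ 2).
    by rewrite sumr_const card_ffun !card_ord mulr_natl.
  apply: eq_bigr => a _.
  rewrite [RHS](reindex_inj (h := fun z => (z.1, shift_in a z.2))) /=.
    by apply: eq_bigr => -[c' x'] _; rewrite gramT_shift.
  by move=> [c1 x1] [c2 x2] /= [-> /shift_in_inj ->].
- by move=> a b [/shift_in_injl].
- by move=> y; rewrite sumr_ge0 // => z _; rewrite sqr_ge0.
Qed.

(** Offsets from [-(k-1)] to [k-1] on each axis, encoded with center [k-1]. *)
Let nbr (x : grid d (S * N)) (t : grid d (2 * k - 1)) : grid d (S * N) :=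
  gwrap SN0 (fun s => (x s)%:Z + (t s)%:Z - (k - 1)%N%:Z).

(** A nonzero product needs one output whose window reaches [x] by [a] and [x'] by [b]; then
    [x' - x = b - a] modulo [S N]. *)
Lemma gramT_support c x c' x' :
  x' \notin codom (nbr x) -> G (c, x) (c', x') = 0.
Proof.
move=> x'P; rewrite /G xpair_eqE [x == x']negbTE ?andbF ?subr0; last first.
  apply: contraNneq x'P => <-.
  (* The diagonal entry, where the identity contributes, has offset zero. *)
  have tP : (k - 1 < 2 * k - 1)%N by lia.
  apply/codomP; exists [ffun=> Ordinal tP]; apply/esym/eqP; rewrite gwrap_eq.
  by apply/forallP => s; rewrite ffunE /= addrK subrr.
rewrite big1 // => m _; rewrite big1 // => i _; rewrite /B /=.
rewrite mulr_suml big1 // => a _; rewrite mulr_sumr big1 // => b _.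
have [xE|] := eqVneq (input_pos i a) x; last by rewrite mulr0 mul0r.
have [x'E|] := eqVneq (input_pos i b) x'; last by rewrite !mulr0.
have tP s : (b s + (k - 1) - a s < 2 * k - 1)%N.
  by have := ltn_ord (a s); have := ltn_ord (b s); lia.
case/negP: x'P; apply/codomP; exists [ffun s => Ordinal (tP s)].
apply/esym/eqP; rewrite -x'E gwrap_eqmod; apply/forallP => s.
rewrite ffunE -xE ffunE wrapE.
set u := (a s)%:Z + _ - _; apply/dvdzP; exists (- (u %/ (S * N)%N%:Z)%Z).
have uE := divz_eq u (S * N)%N%:Z.
have abE : (Ordinal (tP s))%:Z = (b s)%:Z + (k - 1)%N%:Z - (a s)%:Z.
  by have := ltn_ord (a s); rewrite /=; lia.
have -> : (u %% (S * N)%N%:Z)%Z = u - (u %/ (S * N)%N%:Z)%Z * (S * N)%N%:Z.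
  by apply: (addrI ((u %/ (S * N)%N%:Z)%Z * (S * N)%N%:Z)); rewrite -uE; ring.
by rewrite abE /u; ring.
Qed.

Lemma gramT_row_sum_sqr_le p :
  (\sum_r `|(A^T *m A - 1%:M) p r|) ^+ 2 <=
  alpha R CO d M C k S * Lorth CO S K.
Proof.
under eq_bigr do rewrite gramT_sub1E.
case: (enum_val p) => c x.
rewrite (sum_enum_val (fun z => `|G (c, x) z|)).
pose P := [set (cx.1, nbr x cx.2) | cx in {: 'I_C * grid d (2 * k - 1)}].
rewrite (bigID [in P]) /= [X in _ + X]big1 ?addr0; last first.
  move=> [c' x'] zP; rewrite gramT_support ?normr0 //.
  apply: contraNN zP => /codomP[t ->]; apply/imsetP; by exists (c', t).
apply: le_trans (sqr_sum_le_card _ _) _.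
apply: ler_pM; rewrite ?ler0n ?sumr_ge0 //.
  by move=> ? _; rewrite sqr_ge0.
  rewrite ler_nat; apply: leq_trans (leq_imset_card _ _) _.
  by rewrite card_prod card_ffun !card_ord mulnC.
apply: le_trans (gramT_row_sqr_le (c, x)).
under eq_bigr do rewrite real_normK ?num_real //.
rewrite [leRHS](bigID [in P]) /= lerDl sumr_ge0 // => z _; exact: sqr_ge0.
Qed.

(** * Two-sided bounds on the orthogonality error *)

Let err_bound o := alpha R o d M C k S * Lorth o S K.

Lemma singular_value_RO_le s :
  singular_value (A *m A^T - 1%:M) s -> s ^+ 2 <= err_bound RO.
Proof.
rewrite /err_bound Lorth_ROE; apply: singular_value_sqr_le gram_row_sum_sqr_le.
by have := trmx_gram_sub1 A^T; rewrite trmxK.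
Qed.

Lemma singular_value_CO_le s :
  singular_value (A^T *m A - 1%:M) s -> s ^+ 2 <= err_bound CO.
Proof.
exact: singular_value_sqr_le (trmx_gram_sub1 A) gramT_row_sum_sqr_le.
Qed.

(** The squared Frobenius norm [N^d Lorth] is at most the matrix size times the squared spectral
    norm; the factor [N^d] of the size cancels. *)
Lemma Lorth_le_err o :
  Lorth o S K <= (if o is RO then M else C * S ^ d)%N%:R * err_s o S N K ^+ 2.
Proof.
have Nd0 : 0 < (N ^ d)%:R :> R by rewrite ltr0n expn_gt0 N0.
rewrite -(ler_pM2l Nd0) mulrA -natrM; case: o.
  rewrite Lorth_ROE -sum_sqr_gram.
  have -> : (N ^ d * M = #|{: 'I_M * grid d N}|)%N.
    by rewrite card_prod card_ffun !card_ord mulnC.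
  apply: frobenius_le_spectral_norm.
  by have := trmx_gram_sub1 A^T; rewrite trmxK.
rewrite -sum_sqr_gramT.
have -> : (N ^ d * (C * S ^ d) = #|{: 'I_C * grid d (S * N)}|)%N.
  by rewrite card_prod card_ffun !card_ord expnMn; lia.
exact: frobenius_le_spectral_norm (trmx_gram_sub1 A).
Qed.

(** [N^d Lorth] is a sum of squares, also in the CO case, where a difference defines [Lorth]. *)
Lemma Lorth_ge0 o : 0 <= Lorth o S K.
Proof.
have Nd0 : 0 < (N ^ d)%:R :> R by rewrite ltr0n expn_gt0 N0.
rewrite -(pmulr_rge0 _ Nd0); case: o.
  rewrite Lorth_ROE -sum_sqr_gram.
  by do 2!apply: sumr_ge0 => ? _; apply: sqr_ge0.
by rewrite -sum_sqr_gramT; do 2!apply: sumr_ge0 => ? _; apply: sqr_ge0.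
Qed.

(** If [o] and [o'] differ, then [M = C S^d]: the two values of [Lorth] agree, [A] is square, and
    singular values pass between the Gram matrices. *)
Lemma err_le_Lorth o o' : applicable o d M C S -> applicable o' d M C S ->
  err_s o S N K ^+ 2 <= alpha R o' d M C k S * Lorth o S K.
Proof.
move=> ho ho'; have b0 : 0 <= alpha R o' d M C k S * Lorth o S K.
  by rewrite mulr_ge0 ?Lorth_ge0 //; case: (o').
have LE : M = (C * S ^ d)%N -> Lorth RO S K = Lorth CO S K.
  move/eqP; rewrite -(eqr_nat R) -subr_eq0 => /eqP ME.
  by rewrite /Lorth ME subr0.
have cardE : M = (C * S ^ d)%N ->
    #|{: 'I_M * grid d N}| = #|{: 'I_C * grid d (S * N)}|.
  by rewrite !card_prod !card_ffun !card_ord expnMn mulnA => {1}->.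
case: o o' ho ho' b0 => -[] ho ho' b0; apply: spectral_norm_sqr_le b0 _ => s.
- exact: singular_value_RO_le.
- have ME : M = (C * S ^ d)%N by apply/eqP; rewrite eqn_leq; apply/andP.
  rewrite LE // => /singular_value_gram_swap sA.
  exact/singular_value_CO_le/sA/cardE.
- have ME : M = (C * S ^ d)%N by apply/eqP; rewrite eqn_leq; apply/andP.
  rewrite -LE // => As; apply: singular_value_RO_le.
  rewrite -[X in X *m _]trmxK; apply: singular_value_gram_swap.
    exact/esym/cardE.
  by rewrite trmxK.
- exact: singular_value_CO_le.
Qed.

End Layer.

Unset Implicit Arguments.

(* [o] selects the case defining err and Lorth, [o'] the value of alpha; they
   can differ only when M = C S^d, where either value of alpha is valid. *)
Theorem theorem8 (R : realType) (d M C k S N : nat)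
    (hd : d = 1%N \/ d = 2%N)
    (hM : (0 < M)%N) (hC : (0 < C)%N) (hk : (0 < k)%N) (hS : (0 < S)%N)
    (hN : (0 < N)%N) (k_odd : odd k) (hSN : (2 * k - 1 <= S * N)%N)
    (K : 'I_M -> 'I_C -> {ffun 'I_d -> 'I_k} -> R)
    (o o' : orth_case)
    (ho : applicable o d M C S) (ho' : applicable o' d M C S) :
  alpha' R M C S * Lorth o S K <= err_s o S N K ^+ 2
  /\ err_s o S N K ^+ 2 <= alpha R o' d M C k S * Lorth o S K.
Proof.
split; last exact: err_le_Lorth.
rewrite /alpha' div1r ler_pdivrMl; last first.
  by rewrite ltr0n leq_min hM muln_gt0 hC expn_gt0 hS.
apply: le_trans (Lorth_le_err K hS hN hk hSN o) _.
apply: ler_wpM2r; first exact: sqr_ge0.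
(* As [d <= 2], the factor [M] (RO) or [C S^d] (CO) is at most both [M] and [C S^2]. *)
have dS : (C * S ^ d <= C * S ^ 2)%N.
  by rewrite leq_mul2l leq_pexp2l ?orbT //; case: hd => ->.
rewrite ler_nat leq_min; case: o ho => /= ho.
  by rewrite leqnn (leq_trans ho).
by rewrite ho dS.
Qed.
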